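(* A graph $G$ is a triangle-free $2$-self-centered graph if and only if there are non-negative integers $k,\ell,r,s$ and a graph $X$ which has an SBIC via $(\mathbb{A}_r,\mathbb{B}_s)$ (for some families $\mathbb{A}_r=\{A_1,\dots,A_r\}$ and $\mathbb{B}_s=\{B_1,\dots,B_s\}$ of subsets of $V(X)$) such that $G = GCB_X(k,\ell,\mathbb{A}_r,\mathbb{B}_s)$.
   Context: All graphs are finite and simple. A graph is $2$-self-centered if its diameter and its radius (maximum and minimum eccentricity) are both $2$. $u\sim v$ means $u$ and $v$ are adjacent. $d_X(u,v)$ is the distance in $X$ ($\infty$ if there is no path), and $d_X(u,S)=\min\{d_X(u,v): v\in S\}$ for $S\subseteq V(X)$ ($\infty$ if $S=\emptyset$). The graph $X$ below may have empty vertex set. Equality $G=GCB_X(\dots)$ is understood up to isomorphism. **SBIC.** A graph $X$ has a specialized bi-independent covering via $(\mathbb{A}_r,\mathbb{B}_s)$ (an SBIC via $(\mathbb{A}_r,\mathbb{B}_s)$) if: (i) $X$ is triangle-free. (ii) $\mathbb{A}_r=\{A_1,\dots,A_r\}$ and $\mathbb{B}_s=\{B_1,\dots,B_s\}$ are two (indexed) families of not necessarily distinct independent sets of $X$ such that $V(X)=\bigcup_{i=1}^r A_i=\bigcup_{j=1}^s B_j$. (iii) For all $u,v\in V(X)$, if $d_X(u,v)\ge 3$, then there is $1\le i\le r$ with $u,v\in A_i$ or there is $1\le j\le s$ with $u,v\in B_j$. (iv) For all $u\in V(X)$ and $i\in\{1,\dots,r\}$, if $d_X(u,A_i)\ge 2$,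 then there is $j\in\{1,\dots,s\}$ such that $A_i\cap B_j=\emptyset$ and $u\in B_j$. (v) For all $u\in V(X)$ and $j\in\{1,\dots,s\}$, if $d_X(u,B_j)\ge 2$, then there is $i\in\{1,\dots,r\}$ such that $A_i\cap B_j=\emptyset$ and $u\in A_i$. **$X$-generalized complete bipartite graph.** A graph $G$ is $X$-generalized complete bipartite, denoted $GCB_X(k,\ell,\mathbb{A}_r,\mathbb{B}_s)$ with $k,\ell,r,s\ge 0$, if $X$ has an SBIC via $(\mathbb{A}_r,\mathbb{B}_s)$ and $G$ is constructed as follows (the only edges of $G$ are those listed in (1)--(6)): (1) $V(G)=K\cup L\cup Y\cup Z\cup V(X)$ (disjoint union), where $|K|=k$, $|L|=\ell$, $Y=\{y_1,\dots,y_r\}$ with $|Y|=r$, $Z=\{z_1,\dots,z_s\}$ with $|Z|=s$; moreover $E(X)\subseteq E(G)$. (2) $a\sim t$ for all $a\in K$ and $t\in L\cup Y$. (3) $b\sim t$ for all $b\in L$ and $t\in K\cup Z$. (4) $y_i\sim t$ for all $t\in A_i$ and $1\le i\le r$. (5) $z_j\sim t$ for all $t\in B_j$ and $1\le j\le s$. (6) $y_i\sim z_j$ if and only if $A_i\cap B_j=\emptyset$. In addition the following conditions are required: (7) If $k=0$ and $\ell\ne 0$, then every member of $Y$ has a neighbor in $Z$; moreover, for all $i\ne j$ in $\{1,\dots,r\}$, we have $A_i\cap A_j\ne\emptyset$ or there is $p\in\{1,\dots,s\}$ such that $A_i\cap B_p=A_j\cap B_p=\emptyset$. (8) If $k\ne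 0$ and $\ell=0$, then every member of $Z$ has a neighbor in $Y$; moreover, for all $i\ne j$ in $\{1,\dots,s\}$, we have $B_i\cap B_j\ne\emptyset$ or there is $q\in\{1,\dots,r\}$ such that $B_i\cap A_q=B_j\cap A_q=\emptyset$. (9) If $k=\ell=0$, then $r,s\ge 1$; for all $i\ne j$ in $\{1,\dots,r\}$, we have $A_i\cap A_j\neq\emptyset$ or there is $p\in\{1,\dots,s\}$ such that $A_i\cap B_p=A_j\cap B_p=\emptyset$; and for all $i\ne j$ in $\{1,\dots,s\}$, we have $B_i\cap B_j\neq\emptyset$ or there is $q\in\{1,\dots,r\}$ such that $B_i\cap A_q=B_j\cap A_q=\emptyset$. (10) $r=s=0$ if and only if $V(X)=\emptyset$ and $k,\ell\ge 2$. (11) If $|V(X)|=1$, then $k$ and $\ell$ are non-zero. Convention: either $r=s=0$ and $V(X)=\emptyset$, or $r,s\ge 1$ and $V(X)\ne\emptyset$. *)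

(* Defs.v *)
From mathcomp Require Import all_boot all_order all_algebra.
From mathcomp Require Import constructive_ereal.

Set Implicit Arguments.
Unset Strict Implicit.
Unset Printing Implicit Defensive.

Import Order.TTheory GRing.Theory Num.Theory.

Record sgraph := SGraph {
  vertex :> finType;
  adj : rel vertex;
  adj_sym : symmetric adj;
  adj_irrefl : irreflexive adj
}.

Notation "u -- v" := (adj u v) (at level 30, no associativity).

Definition triangle_free (X : sgraph) : Prop :=
  forall u v w : X, ~ [/\ u -- v, v -- w & u -- w].

Definition independent (X : sgraph) (S : {set X}) : Prop :=
  forall u v : X, u \in S -> v \in S -> ~~ (u -- v).

Definition graph_iso (G H : sgraph) : Prop :=
  exists2 f : G -> H, bijective f & forall u v : G, f u -- f v = u -- v.

Definition walk (X : sgraph) (n : nat) (u v : X) : bool :=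
  [exists p : n.-tuple X, path (@adj X) u p && (last u p == v)].

(* Distances are extended integers, so that the distance between vertices in
   different components is [+oo]. It is enough to consider walks with fewer
   than #|X| edges; [dist_leP] below gives the unrestricted characterization. *)
Definition dist (X : sgraph) (u v : X) : \bar int :=
  \big[mine/+oo%E]_(n < #|X| | walk n u v) n%:Z%:E%E.

Definition dist_set (X : sgraph) (u : X) (S : {set X}) : \bar int :=
  \big[mine/+oo%E]_(v in S) dist u v.

Definition eccentricity (X : sgraph) (u : X) : \bar int :=
  \big[maxe/-oo%E]_(v : X) dist u v.

(* On the graph without vertices these are [-oo] and [+oo] respectively. *)
Definition diameter (X : sgraph) : \bar int :=
  \big[maxe/-oo%E]_(u : X) eccentricity u.

Definition radius (X : sgraph) : \bar int :=
  \big[mine/+oo%E]_(u : X) eccentricity u.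

Definition two_self_centered (X : sgraph) : Prop :=
  diameter X = 2%:Z%:E%E /\ radius X = 2%:Z%:E%E.

Lemma walkP (X : sgraph) (n : nat) (u v : X) :
  reflect (exists p : seq X, [/\ path (@adj X) u p, last u p = v & size p = n])
          (walk n u v).
Proof.
apply: (iffP existsP) => [[p /andP[pp /eqP lp]]|[p [pp lp sp]]].
  by exists p; rewrite size_tuple.
by exists (tcast sp (in_tuple p)); rewrite val_tcast /= pp lp eqxx.
Qed.

Lemma dist_leP (X : sgraph) (n : nat) (u v : X) :
  reflect
    (exists p : seq X, [/\ path (@adj X) u p, last u p = v & (size p <= n)%N])
    (dist u v <= n%:Z%:E)%E.
Proof.
apply: (iffP idP) => [d_le|[p [pp lp sp]]].
  case: (boolP [exists i : 'I_#|X|, walk i u v && (i <= n)%N]).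
    case/existsP=> i /andP[/walkP[p [pp lp sp]] le_in].
    by exists p; rewrite sp.
  move/existsPn=> nowalk; move: d_le; rewrite leNgt => /negP[].
  apply/bigmin_gtP; split=> [|i wi]; first exact: ltry.
  by move: (nowalk i); rewrite wi /= -ltnNge lte_fin ltz_nat.
case/shortenP: pp lp => p' pp' up' sub lp.
have s' : (size p' < #|X|)%N.
  by have := max_card [in u :: p']; rewrite (card_uniqP up').
have w : walk (Ordinal s') u v by apply/walkP; exists p'.
apply: (@bigmin_inf _ _ _ _ (Ordinal s')) => //.
rewrite lee_fin lez_nat /=; apply: leq_trans sp.
by apply: uniq_leq_size sub; case/andP: up'.
Qed.

(* Specialized bi-independent covering of X; families may repeat members and
   may contain the empty set. *)
Record sbic (X : sgraph) (r s : nat)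
    (A : 'I_r -> {set X}) (B : 'I_s -> {set X}) : Prop := Sbic {
  sbic_triangle_free : triangle_free X;
  sbic_indepA : forall i, independent (A i);
  sbic_indepB : forall j, independent (B j);
  sbic_coverA : \bigcup_i A i = [set: X];
  sbic_coverB : \bigcup_j B j = [set: X];
  sbic_far : forall u v : X, (3%:Z%:E <= dist u v)%E ->
    (exists i, u \in A i /\ v \in A i) \/ (exists j, u \in B j /\ v \in B j);
  sbic_farA : forall (u : X) (i : 'I_r), (2%:Z%:E <= dist_set u (A i))%E ->
    exists j, A i :&: B j = set0 /\ u \in B j;
  sbic_farB : forall (u : X) (j : 'I_s), (2%:Z%:E <= dist_set u (B j))%E ->
    exists i, A i :&: B j = set0 /\ u \in A i
}.

Definition gcb_vertex (X : sgraph) (k l r s : nat) : finType :=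
  ('I_k + 'I_l + ('I_r + 'I_s) + X)%type.

Notation inK a := (inl (inl (inl a))) (only parsing).
Notation inL b := (inl (inl (inr b))) (only parsing).
Notation inY i := (inl (inr (inl i))) (only parsing).
Notation inZ j := (inl (inr (inr j))) (only parsing).
Notation inX x := (inr x) (only parsing).

Definition gcb_arc (X : sgraph) (k l r s : nat)
    (A : 'I_r -> {set X}) (B : 'I_s -> {set X}) : rel (gcb_vertex X k l r s) :=
  fun p q => match p, q with
  | inX u, inX v => u -- v
  | inK _, inL _ => true
  | inK _, inY _ => true
  | inL _, inZ _ => true
  | inY i, inX t => t \in A i
  | inZ j, inX t => t \in B j
  | inY i, inZ j => A i :&: B j == set0
  | _, _ => false
  end.

Definition gcb_adj (X : sgraph) (k l r s : nat)
    (A : 'I_r -> {set X}) (B : 'I_s -> {set X}) : rel (gcb_vertex X k l r s) :=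
  fun p q => gcb_arc A B p q || gcb_arc A B q p.

Lemma gcb_adj_sym (X : sgraph) (k l r s : nat)
    (A : 'I_r -> {set X}) (B : 'I_s -> {set X}) :
  symmetric (@gcb_adj X k l r s A B).
Proof. by move=> p q; rewrite /gcb_adj orbC. Qed.

Lemma gcb_adj_irrefl (X : sgraph) (k l r s : nat)
    (A : 'I_r -> {set X}) (B : 'I_s -> {set X}) :
  irreflexive (@gcb_adj X k l r s A B).
Proof. by case=> [[[a|b]|[i|j]]|x]; rewrite /gcb_adj //= adj_irrefl. Qed.

Definition gcb_graph (X : sgraph) (k l r s : nat)
    (A : 'I_r -> {set X}) (B : 'I_s -> {set X}) : sgraph :=
  SGraph (@gcb_adj_sym X k l r s A B) (@gcb_adj_irrefl X k l r s A B).

(* Any two distinct members of the family F meet, or both miss some common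
   member of the family F'. *)
Definition meet_or_comiss (X : sgraph) (m n : nat)
    (F : 'I_m -> {set X}) (F' : 'I_n -> {set X}) : Prop :=
  forall i j : 'I_m, i != j ->
    F i :&: F j <> set0 \/
    exists p : 'I_n, F i :&: F' p = set0 /\ F j :&: F' p = set0.

(* G is (isomorphic to) GCB_X(k, l, A, B). *)
Record is_GCB (G X : sgraph) (k l r s : nat)
    (A : 'I_r -> {set X}) (B : 'I_s -> {set X}) : Prop := IsGCB {
  gcb_sbic : sbic A B;
  gcb_iso : graph_iso G (gcb_graph k l A B);
  gcb_k0 : k = 0 -> l <> 0 ->
    (forall i : 'I_r, exists j : 'I_s,
       (inY i : gcb_graph k l A B) -- (inZ j : gcb_graph k l A B)) /\
    meet_or_comiss A B;
  gcb_l0 : k <> 0 -> l = 0 ->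
    (forall j : 'I_s, exists i : 'I_r,
       (inZ j : gcb_graph k l A B) -- (inY i : gcb_graph k l A B)) /\
    meet_or_comiss B A;
  gcb_kl0 : k = 0 -> l = 0 ->
    [/\ 1 <= r, 1 <= s, meet_or_comiss A B & meet_or_comiss B A];
  gcb_rs0 : r = 0 /\ s = 0 <-> [/\ #|X| = 0, 2 <= k & 2 <= l];
  gcb_card1 : #|X| = 1 -> k <> 0 /\ l <> 0;
  gcb_convention : [/\ r = 0, s = 0 & #|X| = 0] \/
                   [/\ 1 <= r, 1 <= s & 0 < #|X|]
}.

(* Main.v *)
Require Import Defs.
From mathcomp Require Import all_boot.
From mathcomp Require Import all_order all_algebra constructive_ereal.

(** For the direct implication, fix an edge ab of a triangle-free 2-self-centered
    graph G. If every vertex is adjacent to a or b, then G is complete bipartite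
    with parts N(a) and N(b), each of size at least 2. Otherwise take K = {a},
    L = {b}, Y = N(a) - b, Z = N(b) - a and let X be induced by the remaining
    vertices: all conditions come from locating the common neighbour that two
    nonadjacent vertices must have. With k = l = 1, conditions (7)-(9) are void. *)

Set Implicit Arguments.
Unset Strict Implicit.
Unset Printing Implicit Defensive.

Import Order.TTheory GRing.Theory Num.Theory.

(** * Small distances and 2-self-centredness in terms of adjacency *)

Section Distances.

Variable X : sgraph.
Implicit Types (u v : X) (S : {set X}).

Definition near2 u v : bool :=
  [|| u == v, u -- v | [exists w, u -- w && w -- v]].

(** Integrality turns the lower bounds occurring in the SBIC conditions into negated upper bounds,
    to which [dist_leP] applies. *)
Lemma ltn_ereal_int (n : nat) (d : \bar int) :
  (n.+1%:Z%:E <= d)%E = ~~ (d <= n%:Z%:E)%E.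
Proof. by rewrite -ltNge; case: d => [d||] //; rewrite lee_fin lte_fin. Qed.

Lemma dist_le1 u v : (dist u v <= 1%:Z%:E)%E = (u == v) || u -- v.
Proof.
apply/dist_leP/orP => [[[|w [|w' p]] [/= pp lp sp]]|[/eqP<-|uv]] //.
- by left; rewrite lp.
- by right; rewrite -lp; case/andP: pp.
- by exists [::].
- by exists [:: v]; rewrite /= uv.
Qed.

Lemma dist_le2 u v : (dist u v <= 2%:Z%:E)%E = near2 u v.
Proof.
apply/dist_leP/or3P.
- case=> [[|w [|w' [|w'' p]]] [/= pp lp sp]] //.
  + by constructor 1; rewrite lp.
  + by constructor 2; rewrite -lp; case/andP: pp.
  + constructor 3; apply/existsP; exists w.
    by rewrite -lp; case/and3P: pp => -> ->.
- case=> [/eqP<-|uv|/existsP[w /andP[uw wv]]].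
  + by exists [::].
  + by exists [:: v]; rewrite /= uv.
  + by exists [:: w; v]; rewrite /= uw wv.
Qed.

Lemma dist_ge2 u v : (2%:Z%:E <= dist u v)%E = (u != v) && ~~ u -- v.
Proof. by rewrite ltn_ereal_int dist_le1 negb_or. Qed.

Lemma dist_ge3 u v : (3%:Z%:E <= dist u v)%E = ~~ near2 u v.
Proof. by rewrite ltn_ereal_int dist_le2. Qed.

Lemma dist_set_ge2P u S :
  reflect (u \notin S /\ forall v, v \in S -> ~~ u -- v)
          (2%:Z%:E <= dist_set u S)%E.
Proof.
apply: (iffP idP) => [/bigmin_geP[_ farS]|[uS farS]].
  split=> [|v vS]; last by have := farS v vS; rewrite dist_ge2 => /andP[].
  by apply/negP=> uS; have := farS u uS; rewrite dist_ge2 eqxx.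
(* For empty [S] only the default value [+oo] of the minimum remains, and it satisfies the bound. *)
apply/bigmin_geP; split=> [|v vS]; first exact: leey.
by rewrite dist_ge2 farS // andbT; apply: contraNneq uS => ->.
Qed.

(** Diameter 2 puts all pairs within distance 2, and radius 2 forbids a vertex of eccentricity at
    most 1. The empty graph is excluded because its diameter is [-oo]. *)
Lemma two_self_centeredP :
  two_self_centered X <->
  [/\ 0 < #|X|, forall u v, near2 u v
    & forall u, exists v, (u != v) && ~~ u -- v].
Proof.
split=> [[diamX radX]|[X0 nearX farX]].
  have nearX u v : near2 u v.
    rewrite -dist_le2 -diamX.
    apply: le_trans (le_bigmax _ _ u).
    exact: (le_bigmax -oo%E (fun w => dist u w) v).
  split=> // [|u].
    rewrite lt0n; apply/eqP => /card0_eq X0.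
    by move: diamX; rewrite /diameter big_pred0.
  apply/existsP; rewrite -[[exists _, _]]negbK; apply/negP => /existsPn nofar.
  have: (2%:Z%:E <= eccentricity u)%E by rewrite -radX; apply: bigmin_le.
  rewrite ltn_ereal_int => /negP[]; apply/bigmax_leP; split=> [|v _].
    exact: leNye.
  by rewrite dist_le1 -[_ || _]negbK negb_or.
have ecc2 u : eccentricity u = 2%:Z%:E%E.
  apply/eqP; rewrite eq_le; apply/andP; split.
    by apply/bigmax_leP; split=> [|v _]; rewrite ?leNye // dist_le2.
  have [v] := farX u; rewrite -dist_ge2 => /le_trans; apply.
  exact: le_bigmax.
have /card_gt0P[u _] := X0.
split; apply/eqP; rewrite eq_le; apply/andP; split.
- by apply/bigmax_leP; split=> [|v _]; rewrite ?leNye // ecc2.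
- by rewrite -{1}(ecc2 u); apply: le_bigmax.
- by rewrite -(ecc2 u); apply: bigmin_le.
- by apply/bigmin_geP; split=> [|v _]; rewrite ?leey // ecc2.
Qed.

End Distances.

Lemma near2_sym (X : sgraph) : symmetric (@near2 X).
Proof.
move=> u v; rewrite /near2 eq_sym adj_sym; congr [|| _, _ | _].
by apply: eq_existsb => w; rewrite andbC; congr (_ && _); apply: adj_sym.
Qed.

Lemma near2_adj (X : sgraph) (u v : X) : u -- v -> near2 u v.
Proof. by rewrite /near2 => ->; rewrite orbT. Qed.

Lemma near2_via (X : sgraph) (w u v : X) : u -- w -> w -- v -> near2 u v.
Proof.
by move=> uw wv; apply/or3P; constructor 3; apply/existsP; exists w; rewrite uw.
Qed.

(** * Invariance under isomorphism *)

Section Isomorphism.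

Variables (G H : sgraph).

Lemma triangle_free_iso : graph_iso G H -> triangle_free H -> triangle_free G.
Proof.
case=> f _ fadj tfH u v w [uv vw uw].
by apply: (tfH (f u) (f v) (f w)); rewrite !fadj.
Qed.

Lemma two_self_centered_iso :
  graph_iso G H -> two_self_centered H -> two_self_centered G.
Proof.
case=> f bij_f fadj; have [g fK gK] := bij_f.
case/two_self_centeredP => H0 nearH farH; apply/two_self_centeredP; split.
- by rewrite (bij_eq_card bij_f).
- move=> u v; case/or3P: (nearH (f u) (f v)) => [/eqP/(can_inj fK)->||].
  + by rewrite /near2 eqxx.
  + by rewrite fadj; apply: near2_adj.
  + case/existsP=> w; rewrite -[w]gK !fadj => /andP[]; exact: near2_via.
- move=> u; have [w] := farH (f u).
  by rewrite -[w]gK fadj (can_eq fK); exists (g w).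
Qed.

(** Made for a map that decodes the vertices of a model [H] into [G]; the isomorphism is its
    inverse, obtained by counting. *)
Lemma graph_iso_surj (g : H -> G) :
  injective g -> (forall v, exists p, g p = v) ->
  (forall p q, g p -- g q = p -- q) -> graph_iso G H.
Proof.
move=> g_inj g_surj g_adj.
have bij_g : bijective g.
  apply: inj_card_bij => //; rewrite -(card_imset predT g_inj).
  apply/subset_leq_card/subsetP => v _; have [p <-] := g_surj v.
  exact: imset_f.
have [f gK fK] := bij_g; exists f; first by exists g.
by move=> u v; rewrite -g_adj !fK.
Qed.

End Isomorphism.

(** * Generalized complete bipartite graphs are triangle-free and 2-self-centered *)

Section GCBSelfCentered.

Variables (G X : sgraph) (k l r s : nat).
Variables (A : 'I_r -> {set X}) (B : 'I_s -> {set X}).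

Local Notation H := (gcb_graph k l A B).

(** Outside X the graph is bipartite with parts K+Z and L+Y. A triangle with one vertex in X would
    use adjacent y_i and z_j, whose sets are disjoint; one with two vertices in X would put an edge
    inside some A_i or B_j. *)
Lemma gcb_triangle_free : sbic A B -> triangle_free H.
Proof.
move=> sAB.
have YX i u v : u \in A i -> v \in A i -> u -- v -> False.
  by move=> uA vA; apply/negP/(sbic_indepA sAB uA vA).
have ZX j u v : u \in B j -> v \in B j -> u -- v -> False.
  by move=> uB vB; apply/negP/(sbic_indepB sAB uB vB).
have YZX i j u : A i :&: B j == set0 -> u \in A i -> u \in B j -> False.
  by move=> /eqP/setP/(_ u) + uA uB; rewrite !inE uA uB.
case=> [[[a|b]|[i|j]]|x] [[[a'|b']|[i'|j']]|x'] [[[a2|b2]|[i2|j2]]|x2] [];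
  rewrite /= /gcb_adj //= ?orbF ?[x' -- x]adj_sym ?[x2 -- x]adj_sym
    ?[x2 -- x']adj_sym ?orbb => h1 h2 h3; eauto.
exact: (sbic_triangle_free sAB (And3 h1 h2 h3)).
Qed.

Hypothesis GH : is_GCB G k l A B.

Let sAB : sbic A B := gcb_sbic GH.

Let coverA u : exists i, u \in A i.
Proof.
have: u \in \bigcup_i A i by rewrite (sbic_coverA sAB).
by case/bigcupP=> i _; exists i.
Qed.

Let coverB u : exists j, u \in B j.
Proof.
have: u \in \bigcup_j B j by rewrite (sbic_coverB sAB).
by case/bigcupP=> j _; exists j.
Qed.

(** By (10), r = s = 0 forces k and l to be at least 2, so Y and Z can stand in for a missing K or
    L. *)
Let rs_inhabited : k = 0 \/ l = 0 -> inhabited 'I_r /\ inhabited 'I_s.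
Proof.
move=> kl0; case: (gcb_convention GH) => [[r0 s0 _]|[r1 s1 _]].
  have [_ k2 l2] := (gcb_rs0 GH).1 (conj r0 s0).
  by case: kl0 => kl0; [rewrite kl0 in k2 | rewrite kl0 in l2].
by split; [exists; exact: (Ordinal r1) | exists; exact: (Ordinal s1)].
Qed.

(** Merges (7) and (9), which cover l nonzero and l = 0. *)
Let comissA : k = 0 -> meet_or_comiss A B.
Proof.
move=> k0; have [l0|/eqP l0] := eqVneq l 0; first by have [] := gcb_kl0 GH k0 l0.
by have [] := gcb_k0 GH k0 l0.
Qed.

Let comissB : l = 0 -> meet_or_comiss B A.
Proof.
move=> l0; have [k0|/eqP k0] := eqVneq k 0; first by have [] := gcb_kl0 GH k0 l0.
by have [] := gcb_l0 GH k0 l0.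
Qed.

(** Orders the five classes so that, by symmetry, 15 of the 25 pairs of classes suffice. *)
Let rank (p : H) : nat :=
  match p with
  | inl (inl (inl _)) => 0
  | inl (inl (inr _)) => 1
  | inl (inr (inl _)) => 2
  | inl (inr (inr _)) => 3
  | inr _ => 4
  end.

Lemma gcb_near2 (p q : H) : near2 p q.
Proof.
have ord0VI n : n = 0 \/ inhabited 'I_n.
  by case: n => [|n]; [left | right; exists; exact: ord0].
have ord_neq0 n : 'I_n -> n <> 0 by case=> m lt_mn n0; rewrite n0 in lt_mn.
wlog: p q / rank p <= rank q => [wl|].
  by case/orP: (leq_total (rank p) (rank q)) => /wl //; rewrite near2_sym.
case: p q => [[[a|b]|[i|j]]|x] [[[a'|b']|[i'|j']]|x'] //= _;
  try by apply: (near2_adj (X := H)).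
- have [l0|[b]] := ord0VI l; last by apply: (near2_via (X := H) (w := inL b)).
  have [[i] _] := rs_inhabited (or_intror l0).
  by apply: (near2_via (X := H) (w := inY i)).
(* K against Z: when L is empty, (8) gives the vertex of Z a neighbour in Y, and Y is joined to all
   of K. *)
- have [l0|[b]] := ord0VI l; last by apply: (near2_via (X := H) (w := inL b)).
  have [/(_ j')[i ji] _] := gcb_l0 GH (ord_neq0 _ a) l0.
  by apply: (near2_via (X := H) (w := inY i)); rewrite // adj_sym.
- have [i xA] := coverA x'.
  by apply: (near2_via (X := H) (w := inY i)) => //=; rewrite /gcb_adj /= xA.
- have [k0|[a]] := ord0VI k; last by apply: (near2_via (X := H) (w := inK a)).
  have [_ [j]] := rs_inhabited (or_introl k0).
  by apply: (near2_via (X := H) (w := inZ j)).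
- have [k0|[a]] := ord0VI k; last by apply: (near2_via (X := H) (w := inK a)).
  have [/(_ i')[j ij] _] := gcb_k0 GH k0 (ord_neq0 _ b).
  by apply: (near2_via (X := H) (w := inZ j)); rewrite // adj_sym.
- have [j xB] := coverB x'.
  by apply: (near2_via (X := H) (w := inZ j)) => //=; rewrite /gcb_adj /= xB.
(* Y against Y: a vertex of K is a common neighbour; if there is none, the alternative in (7) and
   (9) gives one in X or in Z. *)
- have [<-|ii'] := eqVneq i i'; first by rewrite /near2 eqxx.
  have [k0|[a]] := ord0VI k; last by apply: (near2_via (X := H) (w := inK a)).
  have [/eqP/set0Pn[x]|[j [ij i'j]]] := comissA k0 ii'.
    rewrite inE => /andP[xi xi'].
    by apply: (near2_via (X := H) (w := inX x)) => //=; rewrite /gcb_adj /= ?xi ?xi'.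
  by apply: (near2_via (X := H) (w := inZ j)) => //=;
    rewrite /gcb_adj /= ?ij ?i'j eqxx.
- have [ij|/set0Pn[x]] := eqVneq (A i :&: B j') set0.
    by apply: (near2_adj (X := H)); rewrite /= /gcb_adj /= ij eqxx.
  rewrite inE => /andP[xi xj].
  by apply: (near2_via (X := H) (w := inX x)) => //=; rewrite /gcb_adj /= ?xi ?xj.
(* Y against X: at distance at least 2 from A_i, (iv) yields a common neighbour in Z; otherwise the
   vertex lies in A_i or has a neighbour there. *)
- have [/(sbic_farA sAB)[j [ij xj]]|] := boolP (2%:Z%:E <= dist_set x' (A i))%E.
    by apply: (near2_via (X := H) (w := inZ j)) => //=;
      rewrite /gcb_adj /= ?ij ?eqxx ?xj.
  case: (boolP (x' \in A i)) => [xi _|xi /dist_set_ge2P far].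
    by apply: (near2_adj (X := H)); rewrite /= /gcb_adj /= xi.
  have /existsP[v /andP[vi xv]] : [exists v : X, (v \in A i) && x' -- v].
    apply: contraPT far => /existsPn nv; apply; split=> // v vi.
    by have := nv v; rewrite vi.
  by apply: (near2_via (X := H) (w := inX v)) => //=;
    rewrite /gcb_adj /= ?vi // adj_sym xv.
- have [<-|jj'] := eqVneq j j'; first by rewrite /near2 eqxx.
  have [l0|[b]] := ord0VI l; last by apply: (near2_via (X := H) (w := inL b)).
  have [/eqP/set0Pn[x]|[i [ji j'i]]] := comissB l0 jj'.
    rewrite inE => /andP[xj xj'].
    by apply: (near2_via (X := H) (w := inX x)) => //=; rewrite /gcb_adj /= ?xj ?xj'.
  by apply: (near2_via (X := H) (w := inY i)) => //=;
    rewrite /gcb_adj /= setIC ?ji ?j'i eqxx ?orbT.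
- have [/(sbic_farB sAB)[i [ij xi]]|] := boolP (2%:Z%:E <= dist_set x' (B j))%E.
    by apply: (near2_via (X := H) (w := inY i)) => //=;
      rewrite /gcb_adj /= ?ij ?eqxx ?xi.
  case: (boolP (x' \in B j)) => [xj _|xj /dist_set_ge2P far].
    by apply: (near2_adj (X := H)); rewrite /= /gcb_adj /= xj.
  have /existsP[v /andP[vj xv]] : [exists v : X, (v \in B j) && x' -- v].
    apply: contraPT far => /existsPn nv; apply; split=> // v vj.
    by have := nv v; rewrite vj.
  by apply: (near2_via (X := H) (w := inX v)) => //=;
    rewrite /gcb_adj /= ?vj // adj_sym xv.
(* X against X: pairs not within distance 2 inside X are handled by (iii), through Y or Z. *)
- have [/or3P[/eqP->|xx'|/existsP[w /andP[xw wx']]]|] := boolP (near2 x x').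
  + by rewrite /near2 eqxx.
  + by apply: (near2_adj (X := H)); rewrite /= /gcb_adj /= xx'.
  + by apply: (near2_via (X := H) (w := inX w)) => //=;
      rewrite /gcb_adj /= ?xw ?wx'.
  rewrite -dist_ge3 => /(sbic_far sAB)[[i [xi x'i]]|[j [xj x'j]]].
  + by apply: (near2_via (X := H) (w := inY i)) => //=;
      rewrite /gcb_adj /= ?xi ?x'i.
  + by apply: (near2_via (X := H) (w := inZ j)) => //=;
      rewrite /gcb_adj /= ?xj ?x'j.
Qed.

Lemma gcb_far (p : H) : exists q, (p != q) && ~~ p -- q.
Proof.
case: p => [[[a|b]|[i|j]]|x].
- have [[r0 s0 _]|[_ _ /card_gt0P[x _]]] := gcb_convention GH.
    have [_ k2 _] := (gcb_rs0 GH).1 (conj r0 s0).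
    have /card_gt1P[a1 [a2 [_ _ a12]]] : 1 < #|'I_k| by rewrite card_ord.
    have [a1a|aa1] := eqVneq a1 a; last by exists (inK a1); rewrite eq_sym andbT.
    by exists (inK a2); rewrite -a1a andbT.
  by exists (inX x).
- have [[r0 s0 _]|[_ _ /card_gt0P[x _]]] := gcb_convention GH.
    have [_ _ l2] := (gcb_rs0 GH).1 (conj r0 s0).
    have /card_gt1P[b1 [b2 [_ _ b12]]] : 1 < #|'I_l| by rewrite card_ord.
    have [b1b|bb1] := eqVneq b1 b; last by exists (inL b1); rewrite eq_sym andbT.
    by exists (inL b2); rewrite -b1b andbT.
  by exists (inX x).
- have [[r0 _ _]|[_ _ /card_gt0P[x _]]] := gcb_convention GH.
    by move: (ltn_ord i); rewrite [X in _ < X]r0.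
  (* A vertex x of A_i lies in some B_j, which then meets A_i, so y_i and z_j are nonadjacent. *)
  case: (boolP (x \in A i)) => [xi|xi].
    have [j xj] := coverB x; exists (inZ j); rewrite /= /gcb_adj /= orbF.
    by apply/set0Pn; exists x; rewrite inE xi.
  by exists (inX x); rewrite /= /gcb_adj /= orbF.
- have [[_ s0 _]|[_ _ /card_gt0P[x _]]] := gcb_convention GH.
    by move: (ltn_ord j); rewrite [X in _ < X]s0.
  case: (boolP (x \in B j)) => [xj|xj].
    have [i xi] := coverA x; exists (inY i); rewrite /= /gcb_adj /=.
    by apply/set0Pn; exists x; rewrite inE xi.
  by exists (inX x); rewrite /= /gcb_adj /= orbF.
(* If x is alone in X, (11) makes K nonempty, and K has no edges to X. *)
- have [X1|X2] := leqP #|X| 1.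
    have /eqP X1' : #|X| == 1 by rewrite eqn_leq X1; apply/card_gt0P; exists x.
    have [/eqP] := gcb_card1 GH X1'; rewrite -lt0n => k0 _.
    by exists (inK (Ordinal k0)).
  have /card_gt1P[v [w [_ _ vw]]] := X2.
  have [u xu] : exists u, x != u.
    by have [xv|] := eqVneq x v; [exists w; rewrite xv | exists v].
  (* Either x and u share the independent set A_i, or x misses A_i and y_i is a nonneighbour of
     x. *)
  have [i ui] := coverA u; case: (boolP (x \in A i)) => [xi|xi].
    exists (inX u); rewrite /= /gcb_adj /= (adj_sym u) orbb.
    by rewrite (sbic_indepA sAB xi ui) andbT.
  by exists (inY i); rewrite /= /gcb_adj /=.
Qed.

Lemma gcb_two_self_centered : two_self_centered H.
Proof.
apply/two_self_centeredP; split; [|exact: gcb_near2|exact: gcb_far].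
have [[r0 s0 _]|[_ _ /card_gt0P[x _]]] := gcb_convention GH.
  have [_ k2 _] := (gcb_rs0 GH).1 (conj r0 s0).
  by apply/card_gt0P; exists (inK (Ordinal (ltnW k2))).
by apply/card_gt0P; exists (inX x).
Qed.

End GCBSelfCentered.

(** * Recovering the construction from a vertex colouring *)

Definition induced (G : sgraph) (P : pred G) : sgraph :=
  @SGraph {x : G | P x} (fun u v => val u -- val v)
    (fun u v => adj_sym (val u) (val v)) (fun u => adj_irrefl (val u)).

Section Decomposition.

(* The colours 0, 1, 2, 3 mark the classes K, L, Y, Z; all others mark X. *)
Variables (G : sgraph) (col : G -> nat).

Definition rest : sgraph := induced (fun v => 3 < col v).

(** Edges (4) and (5) force this choice: A_i and B_j must be the neighbourhoods in X of y_i and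
    z_j. *)
Definition traces (c : nat) (i : 'I_#|[set v | col v == c]|) : {set rest} :=
  [set x : rest | enum_val i -- val x].

Local Notation k := #|[set v | col v == 0]|.
Local Notation l := #|[set v | col v == 1]|.
Local Notation A := (@traces 2).
Local Notation B := (@traces 3).
Local Notation H := (gcb_graph k l A B).

Hypothesis nbrK : forall u v, col u = 0 -> u -- v = (col v == 1) || (col v == 2).
Hypothesis nbrL : forall u v, col u = 1 -> u -- v = (col v == 0) || (col v == 3).
Hypothesis indepY : forall u v, col u = 2 -> col v = 2 -> u -- v = false.
Hypothesis indepZ : forall u v, col u = 3 -> col v = 3 -> u -- v = false.
Hypothesis nbrYZ : forall u v, col u = 2 -> col v = 3 ->
  u -- v = ~~ [exists x, [&& 3 < col x, u -- x & v -- x]].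

Definition decode (p : H) : G :=
  match p with
  | inl (inl (inl a)) => enum_val a
  | inl (inl (inr b)) => enum_val b
  | inl (inr (inl i)) => enum_val i
  | inl (inr (inr j)) => enum_val j
  | inr x => val x
  end.

Lemma col_enum c (i : 'I_#|[set v | col v == c]|) : col (enum_val i) = c.
Proof. by have := enum_valP i; rewrite inE => /eqP. Qed.

Lemma enum_col c v : col v = c ->
  exists i : 'I_#|[set u | col u == c]|, enum_val i = v.
Proof.
move=> colv; have v_in : v \in [set u | col u == c] by rewrite inE colv.
by exists (enum_rank_in v_in v); rewrite enum_rankK_in.
Qed.

Lemma decode_inj : injective decode.
Proof.
have colX (x : rest) : 3 < col (val x) := valP x.
move=> p q E; have := congr1 col E; move: E.
(* Equal images have equal colours, so p and q are in the same class, on which decoding is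
   injective. *)
case: p q => [[[a|b]|[i|j]]|x] [[[a'|b']|[i'|j']]|x'] /=;
  rewrite ?col_enum // => E Ec;
  try by [move: (colX x); rewrite Ec | move: (colX x'); rewrite -Ec].
all: by rewrite ?(enum_val_inj E) ?(val_inj E).
Qed.

Lemma decode_surj v : exists p, decode p = v.
Proof.
case Ev: (col v) => [|[|[|[|c]]]].
- by have [a <-] := enum_col Ev; exists (inK a).
- by have [b <-] := enum_col Ev; exists (inL b).
- by have [i <-] := enum_col Ev; exists (inY i).
- by have [j <-] := enum_col Ev; exists (inZ j).
- have vX : 3 < col v by rewrite Ev.
  by exists (inX (exist _ v vX : rest)).
Qed.

Lemma traces_disjoint (i : 'I_#|[set v | col v == 2]|)
    (j : 'I_#|[set v | col v == 3]|) :
  (A i :&: B j == set0) = enum_val i -- enum_val j.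
Proof.
rewrite (nbrYZ (col_enum i) (col_enum j)) -[LHS]negbK; congr (~~ _).
apply/set0Pn/existsP => [[x]|[x /and3P[xX ix jx]]].
  rewrite !inE => /andP[ix jx]; exists (val x); rewrite ix jx !andbT.
  exact: (valP x).
by exists (exist _ x xX : rest); rewrite !inE /= ix jx.
Qed.

(** Edges inside X or from X to Y and Z agree by the choice of [rest] and [traces]; those at K and L
    follow from [nbrK] and [nbrL], and those within Y and Z from the other three hypotheses. *)
Lemma decode_adj p q : decode p -- decode q = p -- q.
Proof.
have colX (x : rest) c : (c <= 3) -> (col (val x) == c) = false.
  by move=> c3; apply: gtn_eqF; apply: leq_ltn_trans (valP x).
rewrite [RHS]/= /gcb_adj.
case: p q => [[[a|b]|[i|j]]|x] [[[a'|b']|[i'|j']]|x'] /=; rewrite ?orbF;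
  try by [ rewrite nbrK ?col_enum ?colX
         | rewrite nbrL ?col_enum ?colX
         | rewrite adj_sym nbrK ?col_enum ?colX
         | rewrite adj_sym nbrL ?col_enum ?colX
         | rewrite indepY ?col_enum | rewrite indepZ ?col_enum
         | rewrite traces_disjoint | rewrite traces_disjoint adj_sym
         | rewrite inE | rewrite inE adj_sym
         | rewrite adj_sym orbb ].
Qed.

Lemma decode_iso : graph_iso G H.
Proof. exact: graph_iso_surj decode_inj decode_surj decode_adj. Qed.

End Decomposition.

(** Positive k and l make (7)-(9) vacuous and give (11); (10) and the convention come from the final
    alternative. *)
Lemma is_GCB_pos (G X : sgraph) (k l r s : nat)
    (A : 'I_r -> {set X}) (B : 'I_s -> {set X}) :
  sbic A B -> graph_iso G (gcb_graph k l A B) -> 0 < k -> 0 < l ->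
  [/\ r = 0, s = 0, #|X| = 0, 2 <= k & 2 <= l] \/
    [/\ 1 <= r, 1 <= s & 0 < #|X|] ->
  is_GCB G k l A B.
Proof.
move=> sAB iso k_gt0 l_gt0 conv.
have k0 : k <> 0 by apply/eqP; rewrite -lt0n.
have l0 : l <> 0 by apply/eqP; rewrite -lt0n.
split=> //; case: conv => [[r0 s0 X0 k2 l2]|[r1 s1 X1]]; try by [left|right].
- by split.
- by split=> [[r0]|[X0]]; [rewrite r0 in r1 | rewrite X0 in X1].
Qed.

(** * Decomposing a triangle-free 2-self-centered graph along an edge *)

Section FromEdge.

Variables (G : sgraph) (a b : G).
Hypotheses (tfG : triangle_free G) (nearG : forall u v : G, near2 u v)
  (farG : forall u : G, exists v, (u != v) && ~~ u -- v) (ab : a -- b).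

Let no_triangle (u v w : G) : u -- v -> u -- w -> v -- w = false.
Proof. by move=> uv uw; apply/negP => vw; apply: (@tfG u v w). Qed.

Let irr (u v : G) : u -- v -> u != v.
Proof. by apply: contraTneq => ->; rewrite adj_irrefl. Qed.

Let ba : b -- a. Proof. by rewrite adj_sym. Qed.

Let common (u v : G) : u != v -> u -- v = false -> exists w, u -- w /\ v -- w.
Proof.
move=> uv nuv; move: (nearG u v).
rewrite /near2 (negPf uv) nuv => /existsP[w /andP[uw wv]].
by exists w; split; rewrite // adj_sym.
Qed.

Lemma bipartite_is_GCB : (forall v, a -- v || b -- v) ->
  exists (k l r s : nat) (X : sgraph)
         (A : 'I_r -> {set X}) (B : 'I_s -> {set X}),
    sbic A B /\ is_GCB G k l A B.
Proof.
(* K is N(b), and L, the set of nonneighbours of b, is contained in N(a) by [abG]; so a is in K and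
   b in L. *)
move=> abG; pose col v := if b -- v then 0 else 1.
have col0 v : (col v == 0) = b -- v by rewrite /col; case: ifP.
have col1 v : (col v == 1) = ~~ b -- v by rewrite /col; case: ifP.
have col_le1 v : col v <= 1 by rewrite /col; case: ifP.
have colN v c : 1 < c -> (col v == c) = false.
  by move=> c1; apply: ltn_eqF; apply: leq_ltn_trans c1.
have nba v : ~~ b -- v -> a -- v by have := abG v; case: (b -- v); rewrite ?orbF.
have nbrK u v : b -- u -> u -- v = ~~ b -- v.
  move=> bu; case: (boolP (b -- v)) => [bv|nbv]; first exact: (no_triangle bu bv).
  (* If u and v were nonadjacent, their common neighbour w would be adjacent to a, closing a
     triangle with v, or to b, closing one with u. *)
  apply/negPn/negP => /negPf nuv.
  have uv : u != v by apply: contraNneq nbv => <-.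
  have [w [uw vw]] := common uv nuv; have av := nba v nbv.
  have /orP[aw|bw] := abG w.
    by rewrite (no_triangle av aw) in vw.
  by rewrite (no_triangle bu bw) in uw.
(* No colour exceeds 1, so X is empty and the SBIC conditions hold vacuously. *)
have empty (x : rest col) : False.
  by move: (leq_trans (valP x) (col_le1 _)).
exists #|[set v | col v == 0]|, #|[set v | col v == 1]|.
exists #|[set v | col v == 2]|, #|[set v | col v == 3]|.
exists (rest col), (@traces G col 2), (@traces G col 3).
have sAB : sbic (@traces G col 2) (@traces G col 3).
  split; try by move=> x; case: (empty x).
  - by move=> i x; case: (empty x).
  - by move=> j x; case: (empty x).
  - by apply/setP=> x; case: (empty x).
  - by apply/setP=> x; case: (empty x).
split=> //; apply: is_GCB_pos => //.
- apply: decode_iso => u v.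
  + by move/eqP; rewrite col0 col1 colN // orbF => /nbrK.
  + move/eqP; rewrite col0 col1 colN // orbF => nbu.
    case: (boolP (b -- v)) => [bv|nbv]; first by rewrite adj_sym nbrK.
    exact: no_triangle (nba u nbu) (nba v nbv).
  + by move/eqP; rewrite colN.
  + by move/eqP; rewrite colN.
  + by move/eqP; rewrite colN.
- by apply/card_gt0P; exists a; rewrite inE col0.
- by apply/card_gt0P; exists b; rewrite inE col1 adj_irrefl.
left; split.
- by apply: eq_card0 => v; rewrite inE colN.
- by apply: eq_card0 => v; rewrite inE colN.
- by apply: eq_card0 => x; case: (empty x).
(* A nonneighbour of a other than a is adjacent to b, hence a second member of K. *)
- have [v /andP[av nav]] := farG a.
  apply/card_gt1P; exists a, v; rewrite !inE !col0 ba; split=> //.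
  by have := abG v; rewrite (negPf nav).
- have [v /andP[bv nbv]] := farG b.
  by apply/card_gt1P; exists b, v; rewrite !inE !col1 adj_irrefl.
Qed.

(** The vertex [x0] makes X nonempty, so both coverings have at least one member. *)
Lemma far_vertex_is_GCB (x0 : G) : ~~ a -- x0 -> ~~ b -- x0 ->
  exists (k l r s : nat) (X : sgraph)
         (A : 'I_r -> {set X}) (B : 'I_s -> {set X}),
    sbic A B /\ is_GCB G k l A B.
Proof.
move=> nax0 nbx0.
(* Testing a and b first keeps them out of Y and Z; no vertex passes both adjacency tests, as ab is
   an edge. *)
pose col v := if v == a then 0 else if v == b then 1 else
  if a -- v then 2 else if b -- v then 3 else 4.
have ab_neq : b != a := irr ba.
have col0 v : (col v == 0) = (v == a) by rewrite /col; do 4?case: ifP.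
have col1 v : (col v == 1) = (v == b).
  rewrite /col; case: (eqVneq v a) => [->|_].
    by rewrite [RHS]eq_sym (negPf ab_neq).
  by do 3?case: ifP.
have col2 v : (col v == 2) = (v != b) && a -- v.
  rewrite /col; case: (eqVneq v a) => [->|_]; first by rewrite adj_irrefl andbF.
  by do 3?case: ifP.
have col3 v : (col v == 3) = (v != a) && b -- v.
  rewrite /col; case: (eqVneq v a) => [->|_] //.
  case: (eqVneq v b) => [->|_]; first by rewrite adj_irrefl.
  by case: ifP => [av|_]; [rewrite (no_triangle ab av) | case: ifP].
have colX v : (3 < col v) = [&& v != a, v != b, ~~ a -- v & ~~ b -- v].
  by rewrite /col; do 4?case: ifP.
have x0X : 3 < col x0.
  rewrite colX nax0 nbx0 !andbT; apply/andP; split.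
    by apply: contraNneq nbx0 => ->.
  by apply: contraNneq nax0 => ->.
(* A common neighbour of a vertex of X and any other vertex is thus in Y, Z or X, the trichotomy
   behind (iii)-(v). *)
have nbrX (x : rest col) w : val x -- w -> [|| col w == 2, col w == 3 | 3 < col w].
  have := valP x; rewrite /= colX => /and4P[_ _ nax nbx] xw.
  rewrite col2 col3 colX.
  have -> : w != a by apply: contraNneq nax => <-; rewrite adj_sym.
  have -> : w != b by apply: contraNneq nbx => <-; rewrite adj_sym.
  by case: (a -- w); case: (b -- w).
have indepY u v : col u = 2 -> col v = 2 -> u -- v = false.
  move=> /eqP + /eqP; rewrite !col2 => /andP[_ au] /andP[_ av].
  exact: no_triangle au av.
have indepZ u v : col u = 3 -> col v = 3 -> u -- v = false.
  move=> /eqP + /eqP; rewrite !col3 => /andP[_ bu] /andP[_ bv].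
  exact: no_triangle bu bv.
have nbrYZ u v : col u = 2 -> col v = 3 ->
    u -- v = ~~ [exists x, [&& 3 < col x, u -- x & v -- x]].
  move=> /eqP + /eqP; rewrite col2 col3 => /andP[ub au] /andP[va bv].
  apply/idP/existsPn => [uv x|nox].
    by apply/negP => /and3P[_ ux vx]; rewrite (no_triangle uv ux) in vx.
  apply/negPn/negP => /negPf nuv.
  have uv : u != v.
    by apply: contraTneq bv => <-; rewrite (no_triangle ab au).
  (* This w lies in X: u is adjacent to a and v to b, so w can be adjacent to neither, and hence
     equals neither. *)
  have [w [uw vw]] := common uv nuv.
  case/negP: (nox w); rewrite uw vw colX !andbT.
  have ua : u -- a by rewrite adj_sym.
  have vb : v -- b by rewrite adj_sym.
  have naw : a -- w = false by apply: no_triangle uw.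
  have nbw : b -- w = false by apply: no_triangle vw.
  rewrite naw nbw /= andbT; apply/andP; split.
    by apply: contraFneq nbw => ->.
  by apply: contraFneq naw => ->.
have tracesD (i : 'I_#|[set v | col v == 2]|) (j : 'I_#|[set v | col v == 3]|) :
    enum_val i -- enum_val j -> traces i :&: traces j = set0.
  by move=> ij; apply/eqP; rewrite (traces_disjoint nbrYZ).
have coverA : \bigcup_i @traces G col 2 i = [set: rest col].
  apply/setP=> x; rewrite inE; apply/bigcupP.
  have := valP x; rewrite /= colX => /and4P[xa _ /negPf nax /negPf nbx].
  (* The common neighbour of a and x is not b, which is not adjacent to x; so it is in Y. *)
  have [|w [aw xw]] := common _ nax; first by rewrite eq_sym.
  have /eqP/enum_col[i iw] : col w == 2.
    by rewrite col2 aw andbT; apply: contraFneq nbx => <-; rewrite adj_sym.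
  by exists i; rewrite // inE iw adj_sym.
have coverB : \bigcup_j @traces G col 3 j = [set: rest col].
  apply/setP=> x; rewrite inE; apply/bigcupP.
  have := valP x; rewrite /= colX => /and4P[_ xb /negPf nax /negPf nbx].
  have [|w [bw xw]] := common _ nbx; first by rewrite eq_sym.
  have /eqP/enum_col[j jw] : col w == 3.
    by rewrite col3 bw andbT; apply: contraFneq nax => <-; rewrite adj_sym.
  by exists j; rewrite // inE jw adj_sym.
exists #|[set v | col v == 0]|, #|[set v | col v == 1]|.
exists #|[set v | col v == 2]|, #|[set v | col v == 3]|.
exists (rest col), (@traces G col 2), (@traces G col 3).
have sAB : sbic (@traces G col 2) (@traces G col 3).
  split=> //.
  - by move=> u v w [uv vw uw]; apply: (@tfG (val u) (val v) (val w)).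
  - by move=> i u v; rewrite !inE => iu iv; rewrite /= (no_triangle iu iv).
  - by move=> j u v; rewrite !inE => ju jv; rewrite /= (no_triangle ju jv).
  (* Condition (iii): a common neighbour in X would bring u and v within distance 2 in X. *)
  - move=> u v; rewrite dist_ge3 !negb_or => /and3P[uv nuv /existsPn nouv].
    have [|w [uw vw]] := common _ (negPf nuv).
      by rewrite (inj_eq val_inj).
    case/or3P: (nbrX u w uw) => [/eqP/enum_col[i iw]|/eqP/enum_col[j jw]|wX].
    + by left; exists i; rewrite !inE iw !(adj_sym w).
    + by right; exists j; rewrite !inE jw !(adj_sym w).
    + have := nouv (exist _ w wX : rest col).
      by rewrite /= uw adj_sym vw.
  (* Condition (iv): a common neighbour of y_i and u is not in Y, which is independent, nor in X,
     where it would be a member of A_i adjacent to u. So it is some z_j, and its adjacency to y_i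
     makes A_i and B_j disjoint. *)
  - move=> u i /dist_set_ge2P[]; rewrite inE => /negPf niu far.
    have [|w [iw uw]] := common _ niu.
      by apply: contraTneq (valP u) => <-; rewrite /= col_enum.
    case/or3P: (nbrX u w uw) => [/eqP cw|/eqP/enum_col[j jw]|wX].
    + by rewrite (indepY _ _ (col_enum i) cw) in iw.
    + by exists j; rewrite tracesD ?jw // inE jw adj_sym.
    + have := far (exist _ w wX : rest col); rewrite inE /= iw uw.
      by move/(_ isT).
  - move=> u j /dist_set_ge2P[]; rewrite inE => /negPf nju far.
    have [|w [jw uw]] := common _ nju.
      by apply: contraTneq (valP u) => <-; rewrite /= col_enum.
    case/or3P: (nbrX u w uw) => [/eqP/enum_col[i iw]|/eqP cw|wX].
    + by exists i; rewrite tracesD ?inE iw 1?adj_sym.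
    + by rewrite (indepZ _ _ (col_enum j) cw) in jw.
    + have := far (exist _ w wX : rest col); rewrite inE /= jw uw.
      by move/(_ isT).
split=> //; apply: is_GCB_pos => //.
- apply: decode_iso => // u v /eqP.
  + rewrite col0 col1 col2 => /eqP->.
    by case: eqP => [->|_]; rewrite ?ab.
  + rewrite col1 col0 col3 => /eqP->.
    by case: eqP => [->|_]; rewrite ?ba.
- by apply/card_gt0P; exists a; rewrite inE col0.
- by apply/card_gt0P; exists b; rewrite inE col1.
right; pose x1 : rest col := exist _ x0 x0X.
have := in_setT x1; rewrite -coverA => /bigcupP[i _ _].
have := in_setT x1; rewrite -coverB => /bigcupP[j _ _].
split; last by apply/card_gt0P; exists x1.
  exact: leq_ltn_trans (ltn_ord i).
exact: leq_ltn_trans (ltn_ord j).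
Qed.

End FromEdge.

Theorem theorem1 (G : sgraph) :
  (triangle_free G /\ two_self_centered G) <->
  exists (k l r s : nat) (X : sgraph)
         (A : 'I_r -> {set X}) (B : 'I_s -> {set X}),
    sbic A B /\ is_GCB G k l A B.
Proof.
split=> [[tfG /two_self_centeredP[G0 nearG farG]]|].
  have /card_gt0P[a _] := G0.
  (* The middle vertex of a path of length 2 from a to a nonneighbour serves as b. *)
  have [b ab] : exists b, a -- b.
    have [v /andP[av nav]] := farG a; move: (nearG a v).
    by rewrite /near2 (negPf av) (negPf nav) => /existsP[w /andP[aw _]]; exists w.
  have [/forallP abG|/forallPn[x]] := boolP [forall v, a -- v || b -- v].
    exact: bipartite_is_GCB ab abG.
  rewrite negb_or => /andP[]; exact: far_vertex_is_GCB tfG nearG ab x.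
case=> k [l [r [s [X [A [B [sAB GH]]]]]]]; have iso := gcb_iso GH; split.
  exact: triangle_free_iso iso (gcb_triangle_free sAB).
exact: two_self_centered_iso iso (gcb_two_self_centered GH).
Qed.
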